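(* Let $N\in\mathbb{N}$. Then \begin{align*} \sum_{n=1}^{N}\frac{q^n}{1-q^n}+ \sum_{n = 1}^{N}\genfrac{[}{]}{0pt}{}{N}{n}\frac{q^{n(n+1)}}{(q)_n (1 - q^n)} = \ \sum_{n = 1}^{N}\frac{q^n}{(1 - q^n)(q)_n}. \end{align*} Hence if $\nu(i)$ denotes the number of occurrences of the integer $i$ in a partition $\pi$ of some number $m$ and \begin{equation*} w(m, N):=\sum_{n=1}^{N} \sum_{\substack{\pi \in \mathcal{P}(m, N + 1)\\ \text{exactly $n$ parts} > n}} \left\{\nu(n) + 1\right\}, \end{equation*} then \begin{equation*} d(m, N)+w(m, N)=\mathrm{lpt}(m, N). \end{equation*}
   Context: Here $|q|<1$, $(A)_n=(A;q)_n=(1-A)(1-Aq)\cdots(1-Aq^{n-1})$, and $\genfrac{[}{]}{0pt}{}{N}{n}=\frac{(q;q)_N}{(q;q)_n(q;q)_{N-n}}$ is the $q$-binomial coefficient. $\mathcal{P}(m,M)$ is the set of partitions of $m$ with largest part $\le M$; $d(m,N)$ is the number of divisors of $m$ that are $\le N$; $\mathrm{lpt}(m,N)$ is the number of occurrences of the largest parts in those partitions of $m$ whose largest part is $\le N$. *)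

(* Defs.v *)
From HB Require Import structures.
From mathcomp Require Import all_boot all_order all_algebra.
From mathcomp Require Import reals.
From mathcomp.real_closed Require Import complex.

Set Implicit Arguments.
Unset Strict Implicit.
Unset Printing Implicit Defensive.

Definition is_intpart (m : nat) (s : seq nat) : bool :=
  [&& sorted geq s, 0 \notin s & sumn s == m].

Record intpart (m : nat) := IntPart {
  parts :> seq nat;
  parts_is_intpart : is_intpart m parts }.

HB.instance Definition _ m := [isSub for @parts m].
HB.instance Definition _ m := [Countable of intpart m by <:].

(* A partition of m has at most m parts, each at most m; this embedding into a
   finite type serves only to make intpart m a finType, so that sums over all
   partitions of m can be written. *)
Section IntpartFinite.
Variable m : nat.

Lemma leq_size_sumn (s : seq nat) : 0 \notin s -> size s <= sumn s.
Proof.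
elim: s => //= x s IHs; rewrite inE negb_or eq_sym -lt0n => /andP[x_gt0 /IHs].
by rewrite -add1n; apply: leq_add.
Qed.

Lemma leq_mem_sumn (s : seq nat) x : x \in s -> x <= sumn s.
Proof.
elim: s => //= y s IHs; rewrite inE => /orP[/eqP->|/IHs]; first exact: leq_addr.
by move=> le_xs; apply: leq_trans le_xs (leq_addl _ _).
Qed.

Definition intpart_bseq (p : intpart m) : {bseq m of 'I_m.+1} :=
  insubd [bseq] [seq inord i | i <- parts p].

Definition bseq_intpart (s : {bseq m of 'I_m.+1}) : option (intpart m) :=
  insub [seq nat_of_ord i | i <- s].

Lemma intpart_bseqK : pcancel intpart_bseq bseq_intpart.
Proof.
case=> s s_part; rewrite /bseq_intpart /intpart_bseq /=.
have /and3P[_ s0 /eqP sm] := s_part.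
have le_sm : size s <= m by rewrite -sm leq_size_sumn.
rewrite val_insubd size_map le_sm -map_comp map_id_in.
  by rewrite (insubT (is_intpart m) s_part).
by move=> i /leq_mem_sumn; rewrite sm /= => le_im; rewrite inordK.
Qed.

HB.instance Definition _ : isFinite (intpart m) := PCanIsFinite intpart_bseqK.
End IntpartFinite.

Definition largest_part m (p : intpart m) : nat := \max_(i <- p) i.

Definition nu m (p : intpart m) (i : nat) : nat := count_mem i p.

Definition intparts_le (m M : nat) : {set intpart m} :=
  [set p | largest_part p <= M].

Definition w (m N : nat) : nat :=
  \sum_(1 <= n < N.+1)
    \sum_(p in intparts_le m N.+1 | count (fun i => n < i) p == n) (nu p n + 1).

Definition d (m N : nat) : nat := count (fun k => k <= N) (divisors m).

Definition lpt (m N : nat) : nat :=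
  \sum_(p in intparts_le m N) nu p (largest_part p).

Local Open Scope ring_scope.

Definition qpoch (F : fieldType) (A q : F) (n : nat) : F :=
  \prod_(0 <= k < n) (1 - A * q ^+ k).

(* Meant for n <= N only: N - n is truncated subtraction. *)
Definition qbinom (F : fieldType) (q : F) (N n : nat) : F :=
  qpoch q q N / (qpoch q q n * qpoch q q (N - n)).

(* Main.v *)
(* Let [S_N] be the second sum of the identity. The q-Pascal rule
   [N+1, n] = [N, n] + q^(N+1-n) [N, n-1] and the absorption rule
   [N, n-1] / (1 - q^n) = [N+1, n] / (1 - q^(N+1)) give
   S_(N+1) - S_N = q^(N+1)/(1 - q^(N+1)) * sum_(n >= 1) [N+1, n] q^(n^2)/(q)_n,
   and the last sum is 1/(q)_(N+1) - 1 by the finite Durfee square identity;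
   so the identity follows by induction on N. It holds in every commutative
   ring in which all 1 - q^n are units, in particular for the class of X in
   Q[X]/(X^(m+1)). There the three sums are the generating functions of d, w
   and lpt truncated after degree m: removing a largest part M+1 from a
   partition yields the functional equation
   F_(M+1) = F_M + q^(M+1) G_(M+1) from which each of them is computed. *)
Require Import Defs.
From HB Require Import structures.
From mathcomp Require Import all_boot all_order all_algebra.
From mathcomp Require Import reals ring zify.
From mathcomp.real_closed Require Import complex.
Import Order.TTheory GRing.Theory Num.Theory.
Local Open Scope ring_scope.

(** * The identity in a ring where all [1 - q ^+ n.+1] are units *)

Section QSeries.
Variables (A : comUnitRingType) (q : A).

Definition qfact n : A := \prod_(0 <= k < n) (1 - q * q ^+ k).

(** The q-binomial coefficient, given by a q-Pascal recursion so that it involves no division;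
    [gaussE] recovers the quotient. *)
Fixpoint gauss N n : A :=
  match N, n with
  | _, 0 => 1
  | 0, _.+1 => 0
  | N'.+1, n'.+1 => q ^+ n'.+1 * gauss N' n'.+1 + gauss N' n'
  end.

Arguments gauss : simpl never.

Lemma gaussN0 N : gauss N 0 = 1. Proof. by case: N. Qed.

Lemma gaussSS N n :
  gauss N.+1 n.+1 = q ^+ n.+1 * gauss N n.+1 + gauss N n.
Proof. by []. Qed.

Lemma gauss_small N n : (N < n)%N -> gauss N n = 0.
Proof.
elim: N n => [|N IHN] [|n] //; rewrite ltnS => lt_Nn.
by rewrite gaussSS !IHN ?(leq_trans lt_Nn) // mulr0 addr0.
Qed.

Lemma gaussnn n : gauss n n = 1.
Proof.
by elim: n => // n IHn; rewrite gaussSS IHn gauss_small // mulr0 add0r.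
Qed.

Lemma qfact0 : qfact 0 = 1. Proof. by rewrite /qfact big_nil. Qed.

Lemma qfactS n : qfact n.+1 = qfact n * (1 - q ^+ n.+1).
Proof. by rewrite /qfact big_nat_recr //= -exprS. Qed.

(** Induction on [j + k], since the recursion lowers [j] or [k]; the two terms contribute the
    factors in 1 - q^(j+k) = q^j (1 - q^k) + (1 - q^j). *)
Lemma gauss_qfact j k : gauss (j + k) j * (qfact j * qfact k) = qfact (j + k).
Proof.
move: {2}(j + k)%N (erefl (j + k)%N) => s.
elim: s j k => [|s IHs] [|j] k; rewrite ?gaussN0 ?qfact0 ?add0n ?mul1r //.
rewrite addSn => -[def_s]; rewrite gaussSS.
have:= IHs j k def_s; case: k def_s => [|k] def_s IHj.
  by rewrite addn0 gauss_small // gaussnn qfact0; ring.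
have:= IHs j.+1 k; rewrite addSnnS => /(_ def_s) IHjS.
rewrite mulrDl -mulrA [qfact k.+1]qfactS [X in q ^+ _ * X](_ : _ =
   gauss (j + k.+1) j.+1 * (qfact j.+1 * qfact k) * (1 - q ^+ k.+1));
  last by ring.
rewrite IHjS qfactS [X in _ + X](_ : _ =
   gauss (j + k.+1) j * (qfact j * qfact k.+1) * (1 - q ^+ j.+1)); last first.
  by rewrite [qfact k.+1]qfactS; ring.
by rewrite IHj qfactS -addSn exprD; ring.
Qed.

Hypothesis unit_1subX : forall n, 1 - q ^+ n.+1 \is a GRing.unit.

Lemma unit_qfact n : qfact n \is a GRing.unit.
Proof.
elim: n => [|n IHn]; first by rewrite qfact0 unitr1.
by rewrite qfactS unitrM IHn unit_1subX.
Qed.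

Lemma gaussE N n : (n <= N)%N ->
  gauss N n = qfact N / (qfact n * qfact (N - n)).
Proof.
by move=> le_nN; rewrite -{2}(subnKC le_nN) -gauss_qfact subnKC // mulrK //
  unitrM !unit_qfact.
Qed.

Lemma gauss_pascal n k :
  gauss (n + k).+1 n.+1 = gauss (n + k) n.+1 + q ^+ k * gauss (n + k) n.
Proof.
case: k => [|k]; first by rewrite addn0 !gaussnn gauss_small // add0r mulr1.
apply: (@mulIr _ (qfact n.+1 * qfact k.+1)); first by rewrite unitrM !unit_qfact.
rewrite -addSn gauss_qfact mulrDl [X in _ = X + _](_ : _ =
  gauss (n.+1 + k) n.+1 * (qfact n.+1 * qfact k) * (1 - q ^+ k.+1)); last first.
  by rewrite addSnnS [qfact k.+1]qfactS; ring.
rewrite gauss_qfact [X in _ = _ + X](_ : _ = q ^+ k.+1 *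
  (gauss (n + k.+1) n * (qfact n * qfact k.+1)) * (1 - q ^+ n.+1)); last first.
  by rewrite qfactS; ring.
rewrite gauss_qfact addnS qfactS -addnS exprD -addSnnS; ring.
Qed.

Lemma gauss_absorb N n :
  gauss N.+1 n.+1 * (1 - q ^+ n.+1) = gauss N n * (1 - q ^+ N.+1).
Proof.
case: (ltnP N n) => [lt_Nn|le_nN]; first by rewrite !gauss_small // !mul0r.
rewrite -(subnKC le_nN); set k := (N - n)%N.
apply: (@mulIr _ (qfact n * qfact k)); first by rewrite unitrM !unit_qfact.
rewrite [LHS](_ : _ = gauss (n.+1 + k) n.+1 * (qfact n.+1 * qfact k)); last first.
  by rewrite qfactS addSn; ring.
by rewrite gauss_qfact addSn qfactS -gauss_qfact; ring.
Qed.

(* The finite Durfee rectangle identity; the shift [k] makes the induction on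
   [N] close. *)
Lemma sum_gauss_durfee N k :
  \sum_(0 <= n < N.+1) gauss N n * (q ^+ (n * (n + k)) / qfact (n + k))
  = (qfact (N + k))^-1.
Proof.
elim: N k => [|N IHN] k; first by rewrite big_nat1 gaussN0 !mul1r.
set f := fun n => q ^+ (n * (n + k)) / qfact (n + k).
have split_gauss : \sum_(0 <= n < N.+2) gauss N.+1 n * f n =
    \sum_(0 <= n < N.+1) gauss N n * (q ^+ n * f n + f n.+1).
  rewrite big_nat_recl // gaussN0.
  under eq_bigr do rewrite gaussSS mulrDl.
  rewrite big_split /= addrA; under [RHS]eq_bigr do rewrite mulrDr.
  rewrite big_split /=; congr (_ + _).
  transitivity (\sum_(0 <= n < N.+2) gauss N n * (q ^+ n * f n)).
    by rewrite [RHS]big_nat_recl //= gaussN0 !mul1r; congr (_ + _);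
       apply: eq_bigr => n _; ring.
  by rewrite big_nat_recr //= gauss_small // mul0r addr0.
rewrite split_gauss addSnnS -IHN; apply: eq_bigr => n _; congr (_ * _).
(* Over the common denominator (q)_(n+k+1) the numerators are q^(n(n+k+1)) times 1 - q^(n+k+1) and
   q^(n+k+1), which add up to the term for k+1. *)
rewrite /f !addSn !addnS qfactS.
have -> : (n * (n + k).+1 = n + n * (n + k))%N by rewrite mulnS.
have -> : (n.+1 * (n + k).+1 = n + n * (n + k) + (n + k).+1)%N.
  by rewrite mulSn mulnS; ring.
rewrite !exprD !invrM ?unit_qfact //.
by rewrite -[q ^+ n * (_ * _)](mulrK (unit_1subX (n + k))); ring.
Qed.

Lemma qseries_step N :
  \sum_(1 <= n < N.+2)
      gauss N.+1 n * (q ^+ (n * n.+1) / (qfact n * (1 - q ^+ n)))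
  = \sum_(1 <= n < N.+1)
      gauss N n * (q ^+ (n * n.+1) / (qfact n * (1 - q ^+ n)))
    + q ^+ N.+1 / (1 - q ^+ N.+1) * ((qfact N.+1)^-1 - 1).
Proof.
set f := fun n => q ^+ (n * n.+1) / (qfact n * (1 - q ^+ n)).
(* The added term n = N+1 vanishes, so both sums can be compared term by term. *)
have <- : \sum_(1 <= n < N.+2) gauss N n * f n =
    \sum_(1 <= n < N.+1) gauss N n * f n.
  by rewrite [LHS]big_nat_recr //= gauss_small // mul0r addr0.
(* The case k = 0 is the Durfee square identity; its n = 0 term cancels the -1. *)
have := sum_gauss_durfee N.+1 0; rewrite addn0 big_nat_recl // gaussN0.
rewrite mul0n addn0 qfact0 divr1 mulr1 => <-.
rewrite [1 + _ - 1]addrAC subrr add0r mulr_sumr.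
rewrite !big_add1 /= addrC -big_split /=.
rewrite big_nat_cond [RHS]big_nat_cond; apply: eq_bigr => n /andP[/andP[_ ltnN] _].
rewrite ltnS in ltnN.
have pascal : gauss N.+1 n.+1 = gauss N n.+1 + q ^+ (N - n) * gauss N n.
  by rewrite -{1 2 4}(subnKC ltnN) gauss_pascal.
rewrite [X in X * _ = _]pascal mulrDl addrC; congr (_ + _).
rewrite -[gauss N n](mulrK (unit_1subX N)) -gauss_absorb /f addn0.
have eqN : q ^+ N.+1 = q ^+ (N - n) * q ^+ n.+1 by rewrite -exprD addnS subnK.
have -> : (n.+1 * n.+2 = n.+1 * n.+1 + n.+1)%N by rewrite mulnS addnC.
rewrite invrM ?unit_qfact // exprD [X in _ = X / _ * _]eqN.
by rewrite -[RHS](mulrK (unit_1subX n)); ring.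
Qed.

Lemma qseries_identity N :
  \sum_(1 <= n < N.+1) q ^+ n / (1 - q ^+ n)
  + \sum_(1 <= n < N.+1)
      gauss N n * (q ^+ (n * n.+1) / (qfact n * (1 - q ^+ n)))
  = \sum_(1 <= n < N.+1) q ^+ n / ((1 - q ^+ n) * qfact n).
Proof.
elim: N => [|N IHN]; first by rewrite !big_geq // addr0.
rewrite qseries_step big_nat_recr //= [RHS]big_nat_recr //= -IHN.
by rewrite invrM ?unit_qfact //; ring.
Qed.

End QSeries.

Arguments qfact {A} q n.
Arguments gauss {A} q N n : simpl never.

(** * Generating functions truncated after degree [M] *)

Section TruncatedSeries.
Variable M : nat.

Local Notation trunc_series := {poly %/ ('X^(M.+1) : {poly rat})}.
Local Notation q := ('qX : trunc_series).

Lemma coef_in_qpoly (p : {poly rat}) i :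
  (in_qpoly ('X^(M.+1)) p : {poly rat})`_i = if (i <= M)%N then p`_i else 0.
Proof.
by rewrite /= mk_monic_Xn /= -Pdiv.RingMonic.take_poly_rmodp coef_take_poly ltnS.
Qed.

Definition gf (f : nat -> nat) : trunc_series :=
  in_qpoly ('X^(M.+1)) (\poly_(i < M.+1) (f i)%:R).

Lemma coef_gf f i : (i <= M)%N -> (gf f : {poly rat})`_i = (f i)%:R.
Proof. by move=> leiM; rewrite coef_in_qpoly leiM coef_poly ltnS leiM. Qed.

Lemma eq_gf f g : f =1 g -> gf f = gf g.
Proof.
move=> eq_fg; congr in_qpoly.
by apply/polyP=> i; rewrite !coef_poly eq_fg.
Qed.

Lemma gf_inj f g i : (i <= M)%N -> gf f = gf g -> f i = g i.
Proof.
move=> leiM /(congr1 (fun x : trunc_series => (x : {poly rat})`_i)).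
by rewrite !coef_gf // => /eqP; rewrite eqr_nat => /eqP.
Qed.

Lemma gfD f g : gf (fun i => f i + g i)%N = gf f + gf g.
Proof.
rewrite /gf -in_qpolyD; congr in_qpoly.
by apply/polyP=> i; rewrite coefD !coef_poly natrD; case: ifP; rewrite ?addr0.
Qed.

Lemma gf0 : gf (fun=> 0%N) = 0.
Proof.
rewrite /gf -[RHS](in_qpoly0 ('X^(M.+1))); congr in_qpoly.
by apply/polyP=> i; rewrite coef0 coef_poly if_same.
Qed.

Lemma gf_sum (I : Type) (r : seq I) (f : I -> nat -> nat) :
  gf (fun i => \sum_(k <- r) f k i)%N = \sum_(k <- r) gf (f k).
Proof.
elim: r => [|k r IHr].
  by rewrite big_nil -gf0; apply: eq_gf => i; rewrite big_nil.
by rewrite big_cons -IHr -gfD; apply: eq_gf => i; rewrite big_cons.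
Qed.

Lemma gf1 : gf (fun i => i == 0%N) = 1.
Proof.
rewrite /gf -[RHS](in_qpoly1 ('X^(M.+1))); congr in_qpoly.
by apply/polyP=> i; rewrite coef1 coef_poly; case: i => [|i] //=; rewrite if_same.
Qed.

Lemma gf_shift n f :
  q ^+ n * gf f = gf (fun i => if (n <= i)%N then f (i - n)%N else 0%N).
Proof.
rewrite /gf -rmorphXn -rmorphM /=.
apply: val_inj; apply/polyP=> i; rewrite !coef_in_qpoly coefXnM !coef_poly !ltnS.
case: (leqP i M) => // leiM; case: (ltnP i n) => // _.
by rewrite (leq_trans (leq_subr _ _) leiM).
Qed.

(** The class of X is nilpotent, so the finite geometric sum of the powers of [q ^+ n.+1] is an
    inverse. *)
Lemma unit_1subqX n : 1 - q ^+ n.+1 \is a GRing.unit.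
Proof.
have q0 : (q ^+ n.+1) ^+ M.+1 = 0.
  rewrite -exprM -[LHS]mulr1 -gf1 gf_shift -gf0.
  apply: val_inj; apply/polyP=> i; rewrite !coef_in_qpoly.
  case: (leqP i M) => // leiM; rewrite !coef_poly ltnS leiM ifN //.
  by rewrite -ltnNge (leq_ltn_trans leiM) ?leq_pmull.
have := subrX1 (q ^+ n.+1) M.+1; rewrite q0 sub0r => /eqP.
rewrite eqr_oppLR -mulNr opprB eq_sym => /eqP e.
by apply/unitrPr; eexists; exact: e.
Qed.

End TruncatedSeries.

(** * Weighted sums over partitions with bounded parts *)

Section PartitionSums.
Local Open Scope nat_scope.

(** The weight lives on plain sequences, so that it still makes sense when a part is removed and [m]
    changes. *)
Definition psum (W : seq nat -> nat) (M m : nat) : nat :=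
  \sum_(p in intparts_le m M) W p.

Definition part_seqs m M : seq (seq nat) :=
  [seq parts p | p <- enum (intparts_le m M)].

Lemma psumE W M m : psum W M m = \sum_(s <- part_seqs m M) W s.
Proof. by rewrite big_map big_enum. Qed.

Lemma uniq_part_seqs m M : uniq (part_seqs m M).
Proof. by rewrite map_inj_uniq ?enum_uniq //; apply: val_inj. Qed.

Lemma mem_part_seqs m M s :
  (s \in part_seqs m M) = is_intpart m s && all (leq^~ M) s.
Proof.
apply/mapP/andP => [[p]|[s_part /allP s_le]].
  rewrite mem_enum inE => /bigmax_leqP_seq p_le ->; split; first exact: valP.
  by apply/allP=> i ip; apply: p_le.
exists (IntPart s_part) => //; rewrite mem_enum inE.
by apply/bigmax_leqP_seq => i /s_le.
Qed.

Lemma is_intpart_cons m x s : is_intpart m (x :: s) =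
  [&& 0 < x <= m, all (leq^~ x) s & is_intpart (m - x) s].
Proof.
rewrite /is_intpart /= path_sortedE; last first.
  by move=> a b c /= ba cb; apply: leq_trans cb ba.
rewrite inE negb_or eq_sym -lt0n.
case: (0 < x); rewrite /= ?andbF //.
case: (leqP x m) => [lexm|ltmx] /=.
  by rewrite -[in LHS](subnKC lexm) eqn_add2l -!andbA.
suff -> : (x + sumn s == m) = false by rewrite !andbF.
by apply/eqP; lia.
Qed.

(** As parts are listed in decreasing order, a part [M.+1] can only occur if it is the head; the
    tail may contain further copies of it, hence the bound [M.+1] there. *)
Lemma perm_part_seqsS m M :
  perm_eq (part_seqs m M.+1)
    (part_seqs m M ++
     if M < m then [seq M.+1 :: s | s <- part_seqs (m - M.+1) M.+1] else [::]).
Proof.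
apply: uniq_perm; first exact: uniq_part_seqs.
  rewrite cat_uniq uniq_part_seqs /=; apply/andP; split; last first.
    by case: ifP => // _; rewrite map_inj_uniq ?uniq_part_seqs // => s t [].
  apply/hasPn => s; case: ifP => // _ /mapP[t _ ->].
  by rewrite mem_part_seqs /= ltnn /= andbF.
case=> [|x s]; rewrite mem_cat !mem_part_seqs.
  rewrite [X in _ || X](_ : _ = false) ?orbF //.
  by case: ifP => // _; apply/mapP => -[].
have mem_consS : (x :: s \in if M < m then
    [seq M.+1 :: s | s <- part_seqs (m - M.+1) M.+1] else [::])
    = (x == M.+1) && is_intpart m (x :: s).
  rewrite is_intpart_cons; case: eqP => [->|neq_x] /=; last first.
    by case: ifP => // _; apply/mapP => -[t _ [/neq_x]].
  case: ltnP => //= ltMm; rewrite mem_map => [|? ? []//].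
  by rewrite mem_part_seqs andbC.
rewrite mem_consS; case s_part: is_intpart; last by rewrite andbF.
have:= s_part; rewrite is_intpart_cons => /and3P[_ /allP le_sx _].
have all_le K : x <= K -> all (leq^~ K) s.
  by move=> lexK; apply/allP=> i /le_sx /leq_trans ->.
rewrite /= andbT leq_eqVlt ltnS orbC.
case: (leqP x M) => [lexM|ltMx]; first by rewrite /= !all_le // leqW.
by rewrite /=; case: eqP => //= eq_x; rewrite all_le ?eq_x.
Qed.

Lemma psum0 W m : psum W 0 m = (m == 0) * W [::].
Proof.
rewrite psumE; have part_nil s : s \in part_seqs m 0 -> s = [::].
  rewrite mem_part_seqs; case: s => // x s.
  rewrite is_intpart_cons /= leqn0 lt0n.
  by case/andP=> /and3P[/andP[/negPf-> _]].
have perm_nil : perm_eq (part_seqs m 0) (nseq (m == 0) [::]).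
  apply: uniq_perm => [||s]; [exact: uniq_part_seqs | by case: eqP |].
  case: s => [|x s].
    rewrite mem_part_seqs /is_intpart /= andbT eq_sym mem_nseq eqxx andbT.
    by case: eqP.
  by rewrite mem_nseq andbF; apply/negP => /part_nil.
by rewrite (perm_big _ perm_nil); case: eqP; rewrite /= ?big_seq1 ?big_nil ?mul1n.
Qed.

Lemma psumS W M m : psum W M.+1 m =
  psum W M m + if M < m then psum (fun s => W (M.+1 :: s)) M.+1 (m - M.+1) else 0.
Proof.
rewrite !psumE (perm_big _ (perm_part_seqsS m M)) big_cat /=; congr (_ + _).
by case: ifP => _; rewrite ?big_nil // big_map.
Qed.

Lemma eq_psum W W' M m :
  (forall s, all (leq^~ M) s -> W s = W' s) -> psum W M m = psum W' M m.
Proof.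
move=> eqW; rewrite !psumE big_seq [RHS]big_seq.
by apply: eq_bigr => s; rewrite mem_part_seqs => /andP[_ /eqW].
Qed.

Lemma psumD W W' M m :
  psum (fun s => W s + W' s) M m = psum W M m + psum W' M m.
Proof. exact: big_split. Qed.

Lemma psum_eq0 W M m : (forall s, all (leq^~ M) s -> W s = 0) -> psum W M m = 0.
Proof. by move/eq_psum ->; rewrite /psum big1. Qed.

End PartitionSums.

Lemma count_mem_gt M s : all (leq^~ M) s -> count_mem M.+1 s = 0%N.
Proof.
move=> /allP le_sM; apply/count_memPn/negP => /le_sM.
by rewrite ltnn.
Qed.

(** * Generating functions of [lpt], [d] and [w] *)

Section GeneratingFunctions.
Variable M : nat.
Local Notation gf := (gf M).
Local Notation q := ('qX : {poly %/ ('X^(M.+1) : {poly rat})}).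
Local Notation unit_q := (unit_1subqX M).

Lemma gf_psumS W n : gf (psum W n.+1) =
  gf (psum W n) + q ^+ n.+1 * gf (psum (fun s => W (n.+1 :: s)) n.+1).
Proof. by rewrite gf_shift -gfD; apply: eq_gf => m; rewrite psumS. Qed.

Lemma solve_geom n (x y : {poly %/ ('X^(M.+1) : {poly rat})}) :
  x = y + q ^+ n.+1 * x -> x = y / (1 - q ^+ n.+1).
Proof.
move=> eq_x; apply: (canRL (mulrK (unit_q n))).
by rewrite mulrBr mulr1 {1}eq_x mulrC addrK.
Qed.

Lemma gf_parts n : gf (psum (fun=> 1%N) n) = (qfact q n)^-1.
Proof.
elim: n => [|n IHn].
  by rewrite qfact0 invr1 -gf1; apply: eq_gf => m; rewrite psum0 muln1.
rewrite qfactS invrM ?unit_qfact //; try exact: unit_q.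
by rewrite mulrC -IHn; apply: solve_geom; exact: gf_psumS.
Qed.

(** Prepending a part [n.+1] raises the weight by one, so the series x satisfies x = 1/(q)_(n+1) +
    q^(n+1) x. *)
Lemma gf_parts_nu n : gf (psum (fun s => count_mem n.+1 s + 1)%N n.+1) =
  (qfact q n.+1 * (1 - q ^+ n.+1))^-1.
Proof.
rewrite invrM ?unit_qfact //; try exact: unit_q.
rewrite mulrC -gf_parts; apply: solve_geom.
rewrite {1}gf_psumS [X in _ = X + _]gf_psumS -addrA -mulrDr -gfD.
congr (_ + _ * _); apply: eq_gf => m.
  by apply: eq_psum => s /count_mem_gt ->.
rewrite -psumD; apply: eq_psum => s _ /=.
by rewrite eqxx; lia.
Qed.

Lemma gf_lpt N : gf (lpt ^~ N) =
  \sum_(1 <= n < N.+1) q ^+ n / ((1 - q ^+ n) * qfact q n).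
Proof.
pose W s := count_mem (\max_(i <- s) i) s.
rewrite (_ : gf _ = gf (psum W N)) //.
elim: N => [|N IHN].
  rewrite big_geq // -(gf0 M); apply: eq_gf => m.
  by rewrite psum0 /W muln0.
rewrite big_nat_recr //= -IHN gf_psumS; congr (_ + _ * _).
(* Once [N.+1] is prepended it is the largest part, so [W] counts its copies in [s] plus one. *)
rewrite mulrC -gf_parts_nu; apply: eq_gf => m; apply: eq_psum => s /allP le_s.
rewrite /W big_cons (_ : maxn _ _ = N.+1) /= ?eqxx 1?addnC //.
by apply/maxn_idPl/bigmax_leqP_seq => i /le_s.
Qed.

Lemma dE N m : (0 < m)%N -> d m N = (\sum_(1 <= n < N.+1) (n %| m))%N.
Proof.
move=> m_gt0; elim: N => [|N IHN].
  rewrite big_geq // /d; apply/eqP; rewrite -leqn0 leqNgt -has_count.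
  apply/hasPn => k; rewrite -dvdn_divisors //; case: k => //.
  by rewrite dvd0n eqn0Ngt m_gt0.
rewrite big_nat_recr //= -IHN /d dvdn_divisors //.
rewrite -(count_uniq_mem _ (divisors_uniq _)).
elim: (divisors _) => //= k s ->; rewrite leq_eqVlt ltnS.
by case: eqP => [->|]; rewrite ?ltnn; lia.
Qed.

(* The factor [0 < i] is needed: every [n] divides 0. *)
Lemma gf_d N :
  gf (fun i => \sum_(1 <= n < N.+1) ((0 < i) && (n %| i)))%N =
  \sum_(1 <= n < N.+1) q ^+ n / (1 - q ^+ n).
Proof.
rewrite gf_sum !big_add1 /=; apply: eq_bigr => n _.
(* A positive multiple of [n.+1] is [n.+1] itself or [n.+1] plus a positive multiple. *)
apply: solve_geom; rewrite -[X in X + _]mulr1 -gf1 !gf_shift -gfD.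
apply: eq_gf => m; case: (leqP n.+1 m) => [lt_nm|lt_mn]; last first.
  by case: m lt_mn => //= m lt_mn; rewrite gtnNdvd.
rewrite -{1 2}(subnK lt_nm); case: (m - n.+1)%N => [|k]; first by rewrite dvdnn.
by rewrite dvdn_addl.
Qed.

(** The weight in [w] is the case [j = n]; a separate [j] allows induction, since removing a part
    greater than [n] lowers [j] but not [n]. *)
Definition split_weight n j s : nat :=
  (count (fun i => n < i) s == j)%N * (count_mem n s + 1)%N.

Lemma gf_split_weight0 n j :
  gf (psum (split_weight n j) n) =
  if j is 0 then gf (psum (fun s => count_mem n s + 1)%N n) else 0.
Proof.
have cnt0 s : all (leq^~ n) s -> count (fun i => n < i)%N s = 0%N.
  move=> /allP le_sn; apply/eqP; rewrite -leqn0 leqNgt -has_count.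
  by apply/hasPn => i /le_sn; rewrite -leqNgt.
case: j => [|j]; rewrite -?(gf0 M); apply: eq_gf => m.
  by apply: eq_psum => s /cnt0; rewrite /split_weight => ->; rewrite mul1n.
by apply: psum_eq0 => s /cnt0; rewrite /split_weight => ->.
Qed.

Lemma gf_split_weightS0 n k :
  gf (psum (split_weight n 0) (n + k)) = gf (psum (fun s => count_mem n s + 1)%N n).
Proof.
elim: k => [|k IHk]; first by rewrite addn0 gf_split_weight0.
rewrite addnS gf_psumS IHk [X in _ * X](_ : _ = 0) ?mulr0 ?addr0 //.
rewrite -(gf0 M); apply: eq_gf => m; apply: psum_eq0 => s _.
by rewrite /split_weight /= ltnS leq_addr.
Qed.

Lemma gf_split_weightSS n k j :
  gf (psum (split_weight n j.+1) (n + k).+1) =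
  gf (psum (split_weight n j.+1) (n + k))
  + q ^+ (n + k).+1 * gf (psum (split_weight n j) (n + k).+1).
Proof.
rewrite gf_psumS; congr (_ + _ * _); apply: eq_gf => m; apply: eq_psum => s _.
rewrite /split_weight /= ltnS leq_addr add1n eqSS.
by rewrite (_ : ((n + k).+1 == n) = false) //; apply/eqP; lia.
Qed.

(* The [j] parts exceeding [n] lie in [n+1 .. n+k+1]; subtracting [n+1] from
   each leaves a partition inside a [j x k] box. *)
Lemma gf_split_weight n k j :
  gf (psum (split_weight n j) (n + k).+1) =
  gauss q (j + k) j * q ^+ (j * n.+1)
  * gf (psum (fun s => count_mem n s + 1)%N n).
Proof.
elim: k j => [|k IHk]; elim=> [|j IHj].
- by rewrite -addnS gf_split_weightS0 gaussN0 !mul1r.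
- rewrite gf_split_weightSS IHj !addn0 gf_split_weight0 !gaussnn mulSn exprD.
  by rewrite add0r !mul1r mulrA.
- by rewrite -addnS gf_split_weightS0 gaussN0 !mul1r.
rewrite gf_split_weightSS IHj [in X in X + _]addnS IHk.
(* The removed part n+k+2 splits as (n+1) + (k+1): n+1 completes the exponent (j+1)(n+1), and
   q^(k+1) is the factor in [gauss_pascal]. *)
rewrite [(j.+1 + k.+1)%N]addSn gauss_pascal; last exact: unit_q.
by rewrite addSnnS mulSn -addSn !exprD; ring.
Qed.

Lemma gf_w N : gf (w ^~ N) = \sum_(1 <= n < N.+1)
  gauss q N n * (q ^+ (n * n.+1) / (qfact q n * (1 - q ^+ n))).
Proof.
transitivity (gf (fun m => \sum_(1 <= n < N.+1) psum (split_weight n n) N.+1 m)%N).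
  apply: eq_gf => m; apply: eq_bigr => n _; rewrite big_mkcondr /=.
  by apply: eq_bigr => p _; rewrite /split_weight; case: eqP; rewrite ?mul1n.
rewrite gf_sum big_nat_cond [RHS]big_nat_cond; apply: eq_bigr => n.
rewrite andbT => /andP[n_gt0]; rewrite ltnS => le_nN.
(* With j = n and k = N - n, the bound N+1 on the parts gives an n x (N-n) box, hence
   [gauss q N n]. *)
rewrite -{1}(subnKC le_nN) gf_split_weight subnKC // -mulrA.
by case: n n_gt0 le_nN => // n _ _; rewrite gf_parts_nu.
Qed.

End GeneratingFunctions.

Lemma d_add_w_eq_lpt m N : (0 < m)%N -> (d m N + w m N)%N = lpt m N.
Proof.
move=> m_gt0; rewrite dE //.
pose dpos i := (\sum_(1 <= n < N.+1) ((0 < i) && (n %| i)))%N.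
have -> : (\sum_(1 <= n < N.+1) (n %| m))%N = dpos m by rewrite /dpos m_gt0.
(* Truncating after degree [m] itself keeps the coefficient to be compared. *)
apply: (@gf_inj m (fun i => dpos i + w i N)%N (lpt ^~ N)) => //.
rewrite gfD gf_d gf_w gf_lpt; apply: qseries_identity; exact: unit_1subqX.
Qed.

Theorem theorem7p1 (R : realType) (N : nat) :
  (forall q : R[i], `|q| < 1 ->
     \sum_(1 <= n < N.+1) q ^+ n / (1 - q ^+ n)
     + \sum_(1 <= n < N.+1)
         qbinom q N n * (q ^+ (n * n.+1) / (qpoch q q n * (1 - q ^+ n)))
     = \sum_(1 <= n < N.+1) q ^+ n / ((1 - q ^+ n) * qpoch q q n))
  /\ (forall m : nat, (0 < m)%N -> (d m N + w m N)%N = lpt m N).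
Proof.
split=> [q q_lt1|m]; last exact: d_add_w_eq_lpt.
(* Otherwise q^(n+1) = 1 would have norm 1, against |q| < 1. *)
have unit_q n : 1 - q ^+ n.+1 \is a GRing.unit.
  rewrite unitfE subr_eq0; apply/eqP => /(congr1 Num.norm) /eqP.
  by rewrite normr1 normrX eq_sym lt_eqF // exprn_ilt1.
rewrite -[RHS](qseries_identity _ _ unit_q); congr (_ + _).
rewrite big_nat_cond [RHS]big_nat_cond; apply: eq_bigr => n.
rewrite andbT => /andP[_]; rewrite ltnS => le_nN.
by rewrite gaussE.
Qed.
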